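(* Let $r\le n$ be positive integers, let $A,S,T\in\mathbb{R}^{n\times n}$ and $U,V\in\mathbb{R}^{n\times r}$, and let $A=S\Sigma T^T$ be a singular value decomposition of $A$, where $S$ and $T$ are square orthogonal matrices and $\Sigma=\operatorname{diag}(\sigma_j)_{j=1}^n$ with $\sigma_1\ge\cdots\ge\sigma_n\ge0$. Suppose that $\rho=\operatorname{rank}(A)=n-r$, $\sigma_\rho>0$, and the matrix $C=A+UV^T$ is nonsingular. Write $$S^TU=\begin{pmatrix}\bar U \\ U_r\end{pmatrix},\quad T^TV=\begin{pmatrix}\bar V \\ V_r\end{pmatrix},\quad R_U=\begin{pmatrix}I_\rho&\bar U \\ O_{r,\rho}&U_r\end{pmatrix},\quad R_V=\begin{pmatrix}I_\rho&\bar V \\ O_{r,\rho}&V_r\end{pmatrix},$$ where $U_r$ and $V_r$ are $r\times r$ matrices. Then (a) $R_U\Sigma R_V^T=\Sigma$, $R_U\operatorname{diag}(O_{\rho,\rho},I_r)R_V^T=S^TUV^TT$, and so $$C=SR_UDR_V^TT^T,\qquad D=\Sigma+\operatorname{diag}(O_{\rho,\rho},I_r)=\operatorname{diag}(d_j)_{j=1}^n,$$ where $d_j=\sigma_j$ for $j=1,\dots,\rho$ and $d_j=1$ for $j=\rho+1,\dots,n$. Furthermore, suppose that $\|A\|=1$ and that the $r\times r$ matrices $U_r$ and $V_r$ are nonsingular. Write $$p=\|R_U^{-1}\|\,\|R_V^{-1}\|\quad\text{and}\quad f_r=\max\{1,\|U_r^{-1}\|\}\,\max\{1,\|V_r^{-1}\|\}.$$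 Then (b) $1\le\dfrac{\sigma_\rho(A)}{\sigma_n(C)}\le p$, and (c) $p\le(1+\|U\|)(1+\|V\|)f_r$.
   Context: $\|\cdot\|$ is the spectral norm, $\sigma_j(M)$ is the $j$-th largest singular value of $M$, $I_k$ is the $k\times k$ identity matrix, $O_{k,l}$ is the $k\times l$ zero matrix, and $\operatorname{diag}(M_1,M_2)$ is the block diagonal matrix with diagonal blocks $M_1,M_2$. *)

(* Defs.v *)
From HB Require Import structures.
From mathcomp Require Import all_boot all_order all_algebra.
From mathcomp Require Import polyrcf.
From mathcomp Require Import boolp classical_sets reals.

Set Implicit Arguments.
Unset Strict Implicit.
Unset Printing Implicit Defensive.

Import Order.TTheory GRing.Theory Num.Theory.
Local Open Scope classical_set_scope.
Local Open Scope ring_scope.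

Definition norm2 (R : realType) (n : nat) (x : 'cV[R]_n) : R :=
  Num.sqrt (\sum_(i < n) x i 0 ^+ 2).

(* Operator norm induced by the Euclidean norms. MathComp-Analysis equips
   matrices with the max-entry norm, so `|M| must not be used for this. *)
Definition spectral_norm (R : realType) (m n : nat) (M : 'M[R]_(m, n)) : R :=
  sup [set norm2 (M *m x) | x in [set x : 'cV[R]_n | norm2 x <= 1]].

(* Real roots of p, each repeated according to its multiplicity. *)
Definition roots_with_mult (R : realType) (p : {poly R}) : seq R :=
  flatten [seq nseq (mup x p) x | x <- rootsR p].

(* Square roots of the eigenvalues of M^T M, in nonincreasing order. *)
Definition singular_values (R : realType) (m n : nat) (M : 'M[R]_(m, n)) :
    seq R :=
  sort >=%R [seq Num.sqrt x | x <- roots_with_mult (char_poly (M^T *m M))].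

(* The index j starts from 1, and only 1 <= j <= minn m n is meaningful. *)
Definition singular_value (R : realType) (m n : nat) (j : nat)
    (M : 'M[R]_(m, n)) : R :=
  nth 0 (singular_values M) j.-1.

Definition orthogonal_mx (R : realType) (n : nat) (Q : 'M[R]_n) : Prop :=
  Q^T *m Q = 1%:M.

Definition is_svd (R : realType) (n : nat) (A S : 'M[R]_n) (sigma : 'rV[R]_n)
    (T : 'M[R]_n) : Prop :=
  [/\ orthogonal_mx S, orthogonal_mx T,
      forall i j : 'I_n, (i <= j)%N -> sigma 0 j <= sigma 0 i,
      forall i : 'I_n, 0 <= sigma 0 i
    & A = S *m diag_mx sigma *m T^T].

(* Main.v *)
Require Import Defs.
From HB Require Import structures.
From mathcomp Require Import all_boot all_order all_algebra.
From mathcomp Require Import ring lra.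
From mathcomp Require Import polyrcf complex.
From mathcomp Require Import boolp classical_sets reals.

(** The identities of part (a) are block computations.  Since [A] has rank
    [rho] and its first [rho] singular values are positive, [Sigma] vanishes
    outside its upper left block, which [RU] and [RV] leave alone, whereas
    [RU *m E *m RV^T] is the product [S^T *m U *m V^T *m T].

    Part (b) rests on the variational description of the smallest singular
    value [s] of [C] ([min_singular_value]): [s * |x| <= |C x|] for all [x],
    and equality holds for some [x <> 0].

    For [sigma_rho <= p * s], take such an [x] and solve the factorization
    [C = S RU D RV^T T^T] for [x].  Every diagonal entry of [D] is at least
    [sigma_rho], because [sigma_rho <= |A| = 1], so that inverting [D] costs a
    factor [1 / sigma_rho] and inverting [RU] and [RV^T] costs [p]
    ([min_singular_value_ge]).

    For [s <= sigma_rho], test the variational inequality on the vector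
    [y = T RV^-T e], where [e] is the [rho]-th basis vector.  Then
    [C y = sigma_rho S e] has norm [sigma_rho], while [|y| >= 1], because
    [RV^-T] keeps the upper part of [e] ([norm2_bordered_inv_tr]).

    Part (c) follows from the factorization of the inverse of [RU] as
    [block_mx 1 (- Ubar) 0 1] times [block_mx 1 0 0 (invmx Ur)], whose factors
    have norms at most [1 + |U|] and [max 1 |Ur^-1|]
    ([spectral_norm_invmx_bordered]).

    Singular values being defined here through the roots of a characteristic
    polynomial, the link with norms is the spectral theorem for the symmetric
    matrix [M^T *m M] ([symmetric_spectrum]). *)

Set Implicit Arguments.
Unset Strict Implicit.
Unset Printing Implicit Defensive.

Import Order.TTheory GRing.Theory Num.Theory.
Local Open Scope ring_scope.

(** * The Euclidean norm *)

Lemma sqr_norm2 (R : realType) n (x : 'cV[R]_n) :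
  norm2 x ^+ 2 = \sum_i x i 0 ^+ 2.
Proof. by rewrite sqr_sqrtr ?sumr_ge0 // => i _; rewrite sqr_ge0. Qed.

Lemma norm2_ge0 (R : realType) n (x : 'cV[R]_n) : 0 <= norm2 x.
Proof. exact: sqrtr_ge0. Qed.
#[local] Hint Extern 0 (is_true (0 <= norm2 _)) => exact: norm2_ge0 : core.

Lemma norm2_dot (R : realType) n (x : 'cV[R]_n) :
  (x^T *m x) 0 0 = norm2 x ^+ 2.
Proof. by rewrite sqr_norm2 mxE; apply: eq_bigr => i _; rewrite mxE expr2. Qed.

Lemma norm2_eq0 (R : realType) n (x : 'cV[R]_n) : (norm2 x == 0) = (x == 0).
Proof.
rewrite -sqrf_eq0 sqr_norm2 psumr_eq0; last by move=> i _; exact: sqr_ge0.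
apply/allP/eqP => [x0 | -> i _]; last by rewrite /= mxE expr0n eqxx.
apply/matrixP=> i j; rewrite ord1 mxE; apply/eqP; rewrite -sqrf_eq0.
by apply: x0; rewrite mem_index_enum.
Qed.

Lemma norm20 (R : realType) n : norm2 (0 : 'cV[R]_n) = 0.
Proof. by apply/eqP; rewrite norm2_eq0. Qed.

Lemma norm2Z (R : realType) n (a : R) (x : 'cV[R]_n) :
  norm2 (a *: x) = `|a| * norm2 x.
Proof.
rewrite /norm2 -sqrtr_sqr -sqrtrM ?sqr_ge0 // mulr_sumr.
by congr Num.sqrt; apply: eq_bigr => i _; rewrite mxE exprMn.
Qed.

Lemma norm2N (R : realType) n (x : 'cV[R]_n) : norm2 (- x) = norm2 x.
Proof. by rewrite -scaleN1r norm2Z normrN1 mul1r. Qed.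

(** The squared norm of [b *: x - a *: y], where [a = |x|] and [b = |y|], is
    nonnegative, which is the Cauchy-Schwarz bound multiplied by [2 * a * b]. *)
Lemma dot_le_norm2 (R : realType) n (x y : 'cV[R]_n) :
  (x^T *m y) 0 0 <= norm2 x * norm2 y.
Proof.
have [x0|x0] := eqVneq (norm2 x) 0.
  have /eqP -> : x == 0 by rewrite -norm2_eq0 x0.
  by rewrite trmx0 mul0mx mxE mulr_ge0.
have [y0|y0] := eqVneq (norm2 y) 0.
  have /eqP -> : y == 0 by rewrite -norm2_eq0 y0.
  by rewrite mulmx0 mxE mulr_ge0.
have xp : 0 < norm2 x by rewrite lt_def x0 /=.
have yp : 0 < norm2 y by rewrite lt_def y0 /=.
have : 0 <= \sum_i (norm2 y * x i 0 - norm2 x * y i 0) ^+ 2.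
  by apply: sumr_ge0 => i _; rewrite sqr_ge0.
have -> : \sum_i (norm2 y * x i 0 - norm2 x * y i 0) ^+ 2 =
    norm2 y ^+ 2 * norm2 x ^+ 2 + norm2 x ^+ 2 * norm2 y ^+ 2
    - 2 * norm2 x * norm2 y * (x^T *m y) 0 0.
  rewrite [X in _ * X + _]sqr_norm2 [X in _ + _ * X - _]sqr_norm2 mxE.
  rewrite !mulr_sumr -big_split /= -sumrB.
  by apply: eq_bigr => i _; rewrite mxE; ring.
move=> h; rewrite -(ler_pM2l (mulr_gt0 xp yp)); nra.
Qed.

Lemma sqr_dot_le_norm2 (R : realType) n (x y : 'cV[R]_n) :
  (x^T *m y) 0 0 ^+ 2 <= norm2 x ^+ 2 * norm2 y ^+ 2.
Proof.
rewrite -exprMn -ler_sqrt ?sqr_ge0 // !sqrtr_sqr [leRHS]ger0_norm ?mulr_ge0 //.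
rewrite ler_norml dot_le_norm2 andbT lerNl.
rewrite -(norm2N x) (le_trans _ (dot_le_norm2 _ _)) //.
by rewrite linearN mulNmx [leRHS]mxE.
Qed.

Lemma norm2D (R : realType) n (x y : 'cV[R]_n) :
  norm2 (x + y) <= norm2 x + norm2 y.
Proof.
rewrite -(@ler_pXn2r _ 2) ?nnegrE ?addr_ge0 //.
rewrite -norm2_dot [(x + y)^T]linearD /= mulmxDl !mulmxDr.
have e : (y^T *m x) 0 0 = (x^T *m y) 0 0.
  by rewrite !mxE; apply: eq_bigr => i _; rewrite !mxE mulrC.
move: e (dot_le_norm2 x y) (norm2_dot x) (norm2_dot y).
rewrite [in X in _ -> _ -> _ -> _ -> X]mxE.
rewrite [in X in _ -> _ -> _ -> _ -> X]mxE.
rewrite [X in _ -> _ -> _ -> _ -> _ + X <= _]mxE.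
by move=> -> h -> ->; lra.
Qed.

Lemma sqr_norm2_col_mx (R : realType) m n (x : 'cV[R]_m) (y : 'cV[R]_n) :
  norm2 (col_mx x y) ^+ 2 = norm2 x ^+ 2 + norm2 y ^+ 2.
Proof.
rewrite !sqr_norm2 big_split_ord /=; congr (_ + _); apply: eq_bigr => i _.
  by rewrite col_mxEu.
by rewrite col_mxEd.
Qed.

Lemma norm2_col_mx0 (R : realType) m n (x : 'cV[R]_m) :
  norm2 (col_mx x (0 : 'cV[R]_n)) = norm2 x.
Proof.
apply/eqP; rewrite -(@eqrXn2 _ 2) // sqr_norm2_col_mx norm20.
by rewrite expr0n addr0.
Qed.

Lemma norm2_delta (R : realType) n (i : 'I_n) :
  norm2 (delta_mx i 0 : 'cV[R]_n) = 1.
Proof.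
rewrite /norm2 (bigD1 i) //= mxE !eqxx expr1n big1 ?addr0 ?sqrtr1 // => j ji.
by rewrite mxE (negPf ji) expr0n.
Qed.

Lemma norm2_orthogonal (R : realType) n (Q : 'M[R]_n) (x : 'cV[R]_n) :
  orthogonal_mx Q -> norm2 (Q *m x) = norm2 x.
Proof.
move=> QQ; apply/eqP; rewrite -(@eqrXn2 _ 2) //.
by rewrite -!norm2_dot trmx_mul mulmxA -(mulmxA _ Q^T) QQ mulmx1.
Qed.

Lemma norm2_diag_le (R : realType) n (d : 'rV[R]_n) (K : R) (x : 'cV[R]_n) :
  0 <= K -> (forall i, `|d 0 i| <= K) -> norm2 (diag_mx d *m x) <= K * norm2 x.
Proof.
move=> K0 dK; rewrite -(@ler_pXn2r _ 2) ?nnegrE ?mulr_ge0 //.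
rewrite exprMn !sqr_norm2 mulr_sumr ler_sum // => i _.
rewrite mul_diag_mx mxE exprMn ler_wpM2r ?sqr_ge0 // -[_ ^+ 2]real_normK ?num_real //.
by rewrite lerXn2r ?nnegrE.
Qed.

(** * The spectral norm *)

(** By the Cauchy-Schwarz inequality on each row, the Frobenius norm is such a
    bound.  Without a bound, the supremum defining [spectral_norm] would carry
    no information. *)
Lemma norm2_mulmx_bounded (R : realType) m n (M : 'M[R]_(m, n)) :
  exists2 K : R, 0 <= K & forall x, norm2 (M *m x) <= K * norm2 x.
Proof.
exists (Num.sqrt (\sum_i norm2 (row i M)^T ^+ 2)); first exact: sqrtr_ge0.
move=> x; rewrite -(@ler_pXn2r _ 2) ?nnegrE ?mulr_ge0 ?sqrtr_ge0 //.
rewrite exprMn sqr_norm2 sqr_sqrtr ?sumr_ge0 // => [|i _]; last exact: sqr_ge0.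
rewrite mulr_suml ler_sum // => i _.
have -> : (M *m x) i 0 = ((row i M)^T^T *m x) 0 0.
  by rewrite trmxK -row_mul [RHS]mxE.
exact: sqr_dot_le_norm2.
Qed.

Lemma spectral_norm_le (R : realType) m n (M : 'M[R]_(m, n)) (K : R) :
  0 <= K -> (forall x, norm2 (M *m x) <= K * norm2 x) -> spectral_norm M <= K.
Proof.
move=> K0 MK; apply: ge_sup.
  exists (norm2 (M *m 0)), 0 => //=.
  by rewrite norm20.
move=> _ [x /= x1 <-]; apply: (le_trans (MK x)).
by rewrite -[leRHS]mulr1 ler_wpM2l.
Qed.

Lemma norm2_unit_ball_le (R : realType) m n (M : 'M[R]_(m, n)) (x : 'cV[R]_n) :
  norm2 x <= 1 -> norm2 (M *m x) <= spectral_norm M.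
Proof.
move=> x1; apply: ub_le_sup; last by exists x.
have [K K0 MK] := norm2_mulmx_bounded M.
exists K => _ [y /= y1 <-]; apply: (le_trans (MK y)).
by rewrite -[leRHS]mulr1 ler_wpM2l.
Qed.

Lemma spectral_norm_ge0 (R : realType) m n (M : 'M[R]_(m, n)) :
  0 <= spectral_norm M.
Proof.
apply: (le_trans _ (@norm2_unit_ball_le _ _ _ M 0 _)) => //.
by rewrite norm20.
Qed.
#[local] Hint Extern 0 (is_true (0 <= spectral_norm _)) => exact: spectral_norm_ge0 : core.

Lemma norm2_mulmx_le (R : realType) m n (M : 'M[R]_(m, n)) (x : 'cV[R]_n) :
  norm2 (M *m x) <= spectral_norm M * norm2 x.
Proof.
have [x0|x0] := eqVneq (norm2 x) 0.
  have /eqP -> : x == 0 by rewrite -norm2_eq0 x0.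
  by rewrite mulmx0 !norm20 mulr0.
have xp : 0 < norm2 x by rewrite lt_def x0 /=.
rewrite -ler_pdivrMr // mulrC -[(norm2 x)^-1]ger0_norm ?invr_ge0 //.
rewrite -norm2Z scalemxAr norm2_unit_ball_le // norm2Z.
by rewrite ger0_norm ?invr_ge0 // mulVf.
Qed.

(** This comes from [|M^T x|^2 = x^T (M (M^T x)) <= |x| * |M| * |M^T x|], after
    division by [|M^T x|]. *)
Lemma spectral_norm_tr_le (R : realType) m n (M : 'M[R]_(m, n)) :
  spectral_norm M^T <= spectral_norm M.
Proof.
apply: spectral_norm_le => // x.
have [y0|y0] := eqVneq (norm2 (M^T *m x)) 0; first by rewrite y0 mulr_ge0.
have yp : 0 < norm2 (M^T *m x) by rewrite lt_def y0 /=.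
rewrite -(ler_pM2r yp) -expr2 -norm2_dot trmx_mul trmxK -mulmxA.
rewrite (le_trans (dot_le_norm2 _ _)) // mulrAC [leRHS]mulrC.
by rewrite ler_wpM2l // norm2_mulmx_le.
Qed.

Lemma spectral_norm_orthogonal_le (R : realType) m n (Q : 'M[R]_m)
    (M : 'M[R]_(m, n)) :
  orthogonal_mx Q -> spectral_norm (Q *m M) <= spectral_norm M.
Proof.
move=> QQ; apply: spectral_norm_le => // x.
by rewrite -mulmxA norm2_orthogonal // norm2_mulmx_le.
Qed.

(** * Singular values *)

Lemma roots_with_mult_prod (R : realType) (s : seq R) :
  perm_eq (roots_with_mult (\prod_(x <- s) ('X - x%:P))) s.
Proof.
set p := \prod_(x <- s) _.
have p0 : p != 0 by rewrite monic_neq0 // monic_prod_XsubC.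
have rp : polyrcf.rootsR p =i s.
  by move=> x; rewrite -polyrcf.roots_on_rootsR // root_prod_XsubC.
apply/allP => x _ /=; apply/eqP.
rewrite /roots_with_mult count_flatten -map_comp.
rewrite (eq_map (g := fun y => ((y == x) * mup y p)%N)); last first.
  by move=> y /=; rewrite count_nseq.
rewrite sumnE big_map -(mu_prod_XsubC x s) -/p.
have [xs|xs] := boolP (x \in polyrcf.rootsR p); last first.
  rewrite big1_seq => [|y /= yr].
    by rewrite mupNroot // root_prod_XsubC -rp.
  by case: eqP => // yx; rewrite yx in yr; rewrite yr in xs.
rewrite (bigD1_seq x) //= ?eqxx ?mul1n; last first.
  by rewrite polyrcf.uniq_roots.
by rewrite big1 ?addn0 // => y /negPf ->.
Qed.

Lemma singular_values_of_char_poly (R : realType) m n (M : 'M[R]_(m, n))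
    (s : seq R) :
  char_poly (M^T *m M) = \prod_(x <- s) ('X - x%:P) ->
  singular_values M = sort >=%R [seq Num.sqrt x | x <- s].
Proof.
move=> Ms; apply/perm_sortP.
- by move=> x y; exact: le_total.
- by move=> y x z xy yz; exact: le_trans yz xy.
- by move=> x y /le_anti ->.
by rewrite Ms; apply: perm_map; exact: roots_with_mult_prod.
Qed.

Lemma char_poly_similar (F : fieldType) n (P A : 'M[F]_n) :
  P \in unitmx -> char_poly (invmx P *m A *m P) = char_poly A.
Proof.
move=> uP; pose Pp := map_mx polyC P; pose Pi := map_mx polyC (invmx P).
have PiP : Pi *m Pp = 1%:M by rewrite -map_mxM mulVmx // map_mx1.
have -> : char_poly (invmx P *m A *m P) = \det (Pi *m char_poly_mx A *m Pp).
  rewrite /char_poly /char_poly_mx !map_mxM mulmxBr mulmxBl.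
  by rewrite mul_mx_scalar -scalemxAl PiP scalemx1.
by rewrite !det_mulmx mulrAC -det_mulmx PiP det1 mul1r.
Qed.

Lemma char_poly_diag (F : fieldType) n (d : 'rV[F]_n) :
  char_poly (diag_mx d) = \prod_(i < n) ('X - (d 0 i)%:P).
Proof.
rewrite char_poly_trig ?diag_mx_is_trig //.
by apply: eq_bigr => i _; rewrite mxE eqxx.
Qed.

(** Over [R[i]] the matrix is Hermitian, so it is unitarily similar to a
    diagonal matrix [D] with real entries.  The characteristic polynomial thus
    splits over [R].  If [y] denotes the image of [x] under the unitary change
    of basis, the quadratic form at [x] is the sum of the [D_i * |y_i|^2], and
    the sum of the [|y_i|^2] is the squared norm of [x]. *)
Lemma symmetric_spectrum (R : realType) n (G : 'M[R]_n) :
  G^T = G ->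
  exists2 d : 'rV[R]_n, char_poly G = \prod_(i < n) ('X - (d 0 i)%:P)
  & forall (k : R) (x : 'cV[R]_n), (forall i, k <= d 0 i) ->
      k * norm2 x ^+ 2 <= (x^T *m G *m x) 0 0.
Proof.
move=> symG; pose f : {rmorphism R -> R[i]} := real_complex R.
pose H := map_mx f G.
have conjf y : (f y)^* = f y by apply/CrealP/complex_realP; exists y.
have hermH : H \is hermsymmx.
  apply: realsym_hermsym.
    by apply/is_hermitianmxP; rewrite expr0 scale1r map_mx_id // /H map_trmx symG.
  by apply/mxOverP => i j; rewrite mxE; apply/complex_realP; exists (G i j).
have := hermitian_normalmx hermH => /orthomx_spectralP HE.
have unitP := spectral_unit H.
have unitaryP := spectral_unitarymx H.
have realD := hermitian_spectral_diag_real hermH.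
set P := spectralmx H in HE unitP unitaryP; set D := spectral_diag H in HE realD.
pose d := map_mx (@complex.Re R) D.
have dE i : D 0 i = f (d 0 i).
  by rewrite mxE [RHS]RRe_real //; exact: (mxOverP realD).
exists d.
  apply: (map_poly_inj f); rewrite /= map_char_poly -/H HE char_poly_similar //.
  rewrite char_poly_diag rmorph_prod; apply: eq_bigr => i _.
  by rewrite rmorphB /= map_polyX map_polyC /= dE.
move=> k x kd; pose z := map_mx f x; pose y := P *m z.
have zE : map_mx Num.conj z^T = z^T.
  by apply/matrixP => i j; rewrite !mxE conjf.
have yE : map_mx Num.conj y^T = z^T *m map_mx Num.conj P^T.
  by rewrite trmx_mul map_mxM zE.
(* [y^* *m y] collapses to [z^T *m z], because [P] is unitary and [z] real. *)
have PP : map_mx Num.conj P^T *m P = 1%:M.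
  by rewrite -invmx_unitary // mulVmx.
have qx : f ((x^T *m G *m x) 0 0) = \sum_i f (d 0 i) * `|y i 0| ^+ 2.
  have -> : f ((x^T *m G *m x) 0 0) = (z^T *m H *m z) 0 0.
    by rewrite /z /H map_trmx -!map_mxM [RHS]mxE.
  rewrite HE invmx_unitary // !mulmxA -yE -mulmxA -mulmxA mxE.
  apply: eq_bigr => i _; rewrite mul_diag_mx !mxE dE normCK mulrA; ring.
have nx : f (norm2 x ^+ 2) = \sum_i `|y i 0| ^+ 2.
  have -> : f (norm2 x ^+ 2) = (z^T *m z) 0 0.
    by rewrite -norm2_dot /z map_trmx -map_mxM [RHS]mxE.
  rewrite -[X in X *m z]mulmx1 -PP mulmxA -yE -mulmxA mxE.
  by apply: eq_bigr => i _; rewrite !mxE normCK mulrC.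
rewrite -lecR -[real_complex _ _]/(f _) -[X in _ <= X]/(f _) qx rmorphM nx mulr_sumr.
rewrite ler_sum // => i _; rewrite ler_wpM2r ?exprn_ge0 // lecR; exact: kd.
Qed.

Lemma orthogonal_mx_unit (R : realType) n (Q : 'M[R]_n) :
  orthogonal_mx Q -> Q \in unitmx.
Proof. by move/mulmx1_unit => []. Qed.

Lemma orthogonal_mx_tr (R : realType) n (Q : 'M[R]_n) :
  orthogonal_mx Q -> orthogonal_mx Q^T.
Proof. by move=> QQ; rewrite /orthogonal_mx trmxK; exact: mulmx1C. Qed.

(** [A^T *m A] is orthogonally similar to the diagonal matrix of the squares of
    [sigma], and [sigma], being nonincreasing, is its own sorted list. *)
Lemma svd_singular_value (R : realType) n (A S T : 'M[R]_n) (sigma : 'rV[R]_n)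
    (i : 'I_n) :
  is_svd A S sigma T -> singular_value i.+1 A = sigma 0 i.
Proof.
move=> [SS TT dec_sigma sigma_ge0 AE].
have TTt : T *m T^T = 1%:M by exact: mulmx1C.
have uTt : T^T \in unitmx by rewrite unitmx_tr orthogonal_mx_unit.
have TE : invmx T^T = T by rewrite -[RHS]mulmx1 -(mulmxV uTt) mulmxA TTt mul1mx.
pose d : 'rV[R]_n := \row_j sigma 0 j ^+ 2.
have ATA : A^T *m A = invmx T^T *m diag_mx d *m T^T.
  rewrite TE AE !trmx_mul trmxK tr_diag_mx !mulmxA.
  rewrite -(mulmxA _ S^T S) SS mulmx1 -(mulmxA T) mulmx_diag.
  by congr (_ *m diag_mx _ *m _); apply/rowP => j; rewrite !mxE expr2.
rewrite /singular_value
    (@singular_values_of_char_poly _ _ _ _ [seq d 0 j | j <- enum 'I_n]).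
  rewrite -map_comp (eq_map (g := fun j => sigma 0 j)); last first.
    by move=> j /=; rewrite mxE sqrtr_sqr ger0_norm.
  rewrite sorted_sort => [||]; last 2 first.
  - by move=> y x z xy yz; exact: le_trans yz xy.
  - rewrite sorted_map.
    apply: (@sub_sorted _ (relpre val leq)) => [j k|]; first exact: dec_sigma.
    by rewrite -sorted_map val_enum_ord iota_sorted.
  by rewrite (nth_map i) ?size_enum_ord //= nth_ord_enum.
by rewrite ATA char_poly_similar // char_poly_diag big_map big_enum.
Qed.

Lemma singular_value_ge0 (R : realType) m n j (M : 'M[R]_(m, n)) :
  0 <= singular_value j M.
Proof.
rewrite /singular_value; set s := singular_values M.
have s_ge0 x : x \in s -> 0 <= x.
  by rewrite mem_sort => /mapP [y _ ->]; exact: sqrtr_ge0.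
have [j_lt|j_ge] := ltnP j.-1 (size s); first by rewrite s_ge0 // mem_nth.
by rewrite nth_default.
Qed.

(** The eigenvectors of [C^T *m C] for its least eigenvalue attain the bound,
    and [symmetric_spectrum] shows that no vector goes below it. *)
Lemma min_singular_value (R : realType) n (C : 'M[R]_n) : (0 < n)%N ->
  (exists2 x, 0 < norm2 x & norm2 (C *m x) = singular_value n C * norm2 x)
  /\ (forall x, singular_value n C * norm2 x <= norm2 (C *m x)).
Proof.
move=> n_gt0; set s := singular_value n C.
have symG : (C^T *m C)^T = C^T *m C by rewrite trmx_mul trmxK.
have [d dE d_min] := symmetric_spectrum symG.
have quad x : (x^T *m (C^T *m C) *m x) 0 0 = norm2 (C *m x) ^+ 2.
  by rewrite -norm2_dot trmx_mul !mulmxA.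
have eigv i : exists2 x, 0 < norm2 x & norm2 (C *m x) ^+ 2 = d 0 i * norm2 x ^+ 2.
  have : eigenvalue (C^T *m C) (d 0 i).
    rewrite eigenvalue_root_char dE rootE (bigD1 i) //=.
    by rewrite hornerM hornerXsubC subrr mul0r.
  case/eigenvalueP => v vE v0; exists v^T.
    by rewrite lt_def norm2_ge0 norm2_eq0 trmx_eq0 v0.
  by rewrite -quad trmxK vE -scalemxAl mxE -norm2_dot trmxK.
have d_ge0 i : 0 <= d 0 i.
  have [x x0 xE] := eigv i.
  by rewrite -(@pmulr_lge0 _ (norm2 x ^+ 2)) ?exprn_gt0 // -xE exprn_ge0.
pose L := [seq Num.sqrt (d 0 i) | i <- enum 'I_n].
have sv : singular_values C = sort >=%R L.
  rewrite (@singular_values_of_char_poly _ _ _ _ [seq d 0 i | i <- enum 'I_n]).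
    by rewrite -map_comp.
  by rewrite dE big_map big_enum.
have szL : size (sort >=%R L) = n by rewrite size_sort size_map size_enum_ord.
have s_mem : s \in L.
  by rewrite -(mem_sort >=%R) /s /singular_value sv mem_nth // szL prednK.
(* [s] is the last entry of the nonincreasing list, hence its minimum. *)
have s_min i : s <= Num.sqrt (d 0 i).
  have /(nthP 0) [j] : Num.sqrt (d 0 i) \in sort >=%R L.
    by rewrite mem_sort; apply/mapP; exists i; rewrite ?mem_enum.
  rewrite szL => jn <-; rewrite /s /singular_value sv.
  apply: (@sorted_leq_nth _ >=%R) => //.
  - by move=> y x z xy yz; exact: le_trans yz xy.
  - by move=> x; exact: lexx.
  - by apply: sort_sorted => x y; exact: le_total.
  - by rewrite inE szL.
  - by rewrite inE szL prednK.
  - by rewrite -ltnS prednK.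
have /mapP [i _ sE] := s_mem.
have s_ge0 : 0 <= s by rewrite sE sqrtr_ge0.
split.
  have [x x0 xE] := eigv i; exists x => //; apply/eqP.
  have sqr_s : s ^+ 2 = d 0 i by rewrite sE sqr_sqrtr.
  by rewrite -(@eqrXn2 _ 2) ?mulr_ge0 // xE exprMn sqr_s.
move=> x; rewrite -(@ler_pXn2r _ 2) ?nnegrE ?mulr_ge0 // exprMn -quad.
apply: d_min => j; rewrite -[leRHS]sqr_sqrtr // ler_pXn2r ?nnegrE ?sqrtr_ge0 //.
Qed.

(** The orthogonal factors preserve the rank, and the upper left block of the
    diagonal factor already accounts for all of it. *)
Lemma svd_rsubmx_eq0 (R : realType) rho r (A S T : 'M[R]_(rho + r))
    (sigma : 'rV[R]_(rho + r)) :
  is_svd A S sigma T -> \rank A = rho ->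
  (forall i, 0 < lsubmx sigma 0 i) -> rsubmx sigma = 0.
Proof.
move=> [SS TT _ _ AE] rankA sigma_gt0.
have diag_l_unit : diag_mx (lsubmx sigma) \in unitmx.
  rewrite unitmxE det_diag unitfE prodf_seq_neq0.
  by apply/allP => i _; rewrite gt_eqF.
have : \rank (diag_mx sigma) = rho.
  rewrite -[RHS]rankA AE mxrankMfree ?row_free_unit ?unitmx_tr ?orthogonal_mx_unit //.
  by rewrite eqmxMfull // row_full_unit orthogonal_mx_unit.
rewrite -[in X in X -> _](hsubmxK sigma) diag_mx_row rank_diag_block_mx.
rewrite (mxrank_unit diag_l_unit) => /eqP.
rewrite -[X in _ == X]addn0 eqn_add2l mxrank_eq0 => /eqP/matrixP d0.
by apply/rowP => i; have := d0 i i; rewrite !mxE eqxx.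
Qed.

(** A vector [x] with [|C x| = s * |x|], where [s] is the least singular value,
    satisfies [x = Q'^T D^-1 P' (C x)], so its norm is at most
    [|Q'| * k^-1 * |P'| * s] times itself. *)
Lemma min_singular_value_ge (R : realType) n (C P Q P' Q' : 'M[R]_n)
    (d : 'rV[R]_n) (k : R) :
  (0 < n)%N -> C = P *m diag_mx d *m Q^T -> P' *m P = 1%:M -> Q' *m Q = 1%:M ->
  0 < k -> (forall i, k <= d 0 i) ->
  k <= spectral_norm P' * spectral_norm Q' * singular_value n C.
Proof.
move=> n_gt0 CE PP QQ k0 kd.
have [[x x0 Cx] _] := min_singular_value C n_gt0.
have d0 i : 0 < d 0 i := lt_le_trans k0 (kd i).
pose d' : 'rV[R]_n := \row_i (d 0 i)^-1.
have dd : diag_mx d' *m diag_mx d = 1%:M.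
  rewrite mulmx_diag -diag_const_mx; congr diag_mx.
  by apply/rowP => i; rewrite !mxE mulVf // gt_eqF.
have QQt : Q'^T *m Q^T = 1%:M by rewrite -trmx_mul (mulmx1C QQ) trmx1.
have xE : x = Q'^T *m (diag_mx d' *m (P' *m (C *m x))).
  rewrite CE !mulmxA -(mulmxA _ P' P) PP mulmx1 -(mulmxA _ (diag_mx d')) dd.
  by rewrite mulmx1 QQt mul1mx.
have k'_ge0 : 0 <= k^-1 by rewrite invr_ge0 ltW.
have : norm2 x <= spectral_norm Q' * (k^-1 * (spectral_norm P' * norm2 (C *m x))).
  rewrite {1}xE (le_trans (norm2_mulmx_le _ _)) //.
  apply: ler_pM => //; first exact: spectral_norm_tr_le.
  apply: (le_trans (@norm2_diag_le _ _ _ k^-1 _ k'_ge0 _)) => [i|].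
    by rewrite mxE ger0_norm ?invr_ge0 ?(ltW (d0 i)) // lef_pV2 ?posrE.
  by rewrite ler_wpM2l // norm2_mulmx_le.
rewrite Cx -(ler_pM2l k0) => h; rewrite -(ler_pM2r x0) (le_trans h) //.
by rewrite le_eqVlt; apply/orP; left; apply/eqP; field; rewrite gt_eqF.
Qed.

(** * The block triangular factors *)

(** This is [R_U] when [X = S^T *m U], and [R_V] when [X = T^T *m V]. *)
Definition bordered (R : pzRingType) rho r (X : 'M[R]_(rho + r, r)) :
    'M[R]_(rho + r) :=
  block_mx 1%:M (usubmx X) 0 (dsubmx X).

Lemma bordered_ul_block (R : comPzRingType) rho r (X Y : 'M[R]_(rho + r, r))
    (B : 'M[R]_rho) :
  bordered X *m block_mx B 0 0 0 *m (bordered Y)^T = block_mx B 0 0 0.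
Proof.
rewrite /bordered tr_block_mx !mulmx_block.
by rewrite !(mulmx0, mul0mx, mul1mx, addr0, add0r, trmx0, trmx1, mulmx1).
Qed.

Lemma bordered_dr_block (R : comPzRingType) rho r (X Y : 'M[R]_(rho + r, r)) :
  bordered X *m block_mx 0 0 0 1%:M *m (bordered Y)^T = X *m Y^T.
Proof.
rewrite /bordered tr_block_mx !mulmx_block.
rewrite !(mulmx0, mul0mx, mul1mx, addr0, add0r, trmx0, trmx1, mulmx1).
by rewrite -[in RHS](vsubmxK X) -[in RHS](vsubmxK Y) tr_col_mx mul_col_row.
Qed.

Lemma bordered_unit (R : comUnitRingType) rho r (X : 'M[R]_(rho + r, r)) :
  (bordered X \in unitmx) = (dsubmx X \in unitmx).
Proof. by rewrite !unitmxE det_ublock det1 mul1r. Qed.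

Lemma invmx_bordered (R : comUnitRingType) rho r (X : 'M[R]_(rho + r, r)) :
  dsubmx X \in unitmx ->
  invmx (bordered X) =
    block_mx 1%:M (- (usubmx X *m invmx (dsubmx X))) 0 (invmx (dsubmx X)).
Proof.
move=> uX; have uB : bordered X \in unitmx by rewrite bordered_unit.
rewrite -[LHS]mulmx1; apply: (canLR (mulKmx uB)); rewrite /bordered mulmx_block.
rewrite !(mulmx0, mul0mx, mul1mx, addr0, add0r, mulmx1) addNr mulmxV //.
by rewrite -scalar_mx_block.
Qed.

(** The first block row of [(bordered Y)^T] is that of the identity, and so is
    the first block row of the inverse: the upper half of [col_mx a 0] is kept,
    and the lower half can only add to the norm. *)
Lemma norm2_bordered_inv_tr (R : realType) rho r (Y : 'M[R]_(rho + r, r))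
    (a : 'cV[R]_rho) :
  dsubmx Y \in unitmx ->
  norm2 a <= norm2 ((invmx (bordered Y))^T *m col_mx a 0).
Proof.
move=> uY; rewrite invmx_bordered // tr_block_mx mul_block_col.
rewrite !(mulmx0, addr0, trmx0, trmx1, mul1mx).
rewrite -(@ler_pXn2r _ 2) ?nnegrE // sqr_norm2_col_mx lerDl.
by rewrite exprn_ge0.
Qed.

(** The inverse sends [col_mx a b] to [w + col_mx (- (usubmx X *m c)) 0], where
    [W] is the inverse of [dsubmx X], [c = W *m b] and [w = col_mx a c].  The
    norm of [w] is at most [max 1 |W|] times that of [col_mx a b], and the norm
    of the second term is at most [|X c| <= |X| * |w|]. *)
Lemma spectral_norm_invmx_bordered (R : realType) rho r
    (X : 'M[R]_(rho + r, r)) :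
  dsubmx X \in unitmx ->
  spectral_norm (invmx (bordered X)) <=
    (1 + spectral_norm X) * Num.max 1 (spectral_norm (invmx (dsubmx X))).
Proof.
move=> uX; rewrite invmx_bordered //.
set f := Num.max 1 _; set W := invmx (dsubmx X).
have f1 : 1 <= f by rewrite le_max lexx.
have f_ge0 : 0 <= f by exact: le_trans f1.
apply: spectral_norm_le => [|z]; first by rewrite mulr_ge0 // addr_ge0.
rewrite -[z]vsubmxK; set a := usubmx z; set b := dsubmx z.
have Wb : norm2 (col_mx a (W *m b)) <= f * norm2 (col_mx a b).
  rewrite -(@ler_pXn2r _ 2) ?nnegrE ?mulr_ge0 // exprMn !sqr_norm2_col_mx mulrDr.
  apply: lerD; first by rewrite ler_peMl ?exprn_ge0 // exprn_ege1.
  rewrite -exprMn ler_pXn2r ?nnegrE ?mulr_ge0 //.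
  by rewrite (le_trans (norm2_mulmx_le _ _)) // ler_wpM2r // le_max lexx orbT.
have uXWb : norm2 (usubmx X *m (W *m b)) <=
    spectral_norm X * norm2 (col_mx a (W *m b)).
  apply: (@le_trans _ _ (norm2 (X *m (W *m b)))).
    rewrite -[in leRHS](vsubmxK X) mul_col_mx.
    by rewrite -(@ler_pXn2r _ 2) ?nnegrE // sqr_norm2_col_mx lerDl exprn_ge0.
  rewrite (le_trans (norm2_mulmx_le _ _)) // ler_wpM2l //.
  by rewrite -(@ler_pXn2r _ 2) ?nnegrE // sqr_norm2_col_mx lerDr exprn_ge0.
have -> : block_mx 1%:M (- (usubmx X *m W)) 0 W *m col_mx a b =
    col_mx a (W *m b) + col_mx (- (usubmx X *m (W *m b))) 0.
  by rewrite mul_block_col mul1mx mul0mx add0r add_col_mx addr0 mulNmx mulmxA.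
apply: (le_trans (norm2D _ _)); rewrite norm2_col_mx0 norm2N.
apply: (le_trans (lerD (lexx _) uXWb)).
rewrite -mulrA -[X in X + _ <= _]mul1r -mulrDl.
by rewrite ler_wpM2l // addr_ge0.
Qed.

(** * Conditioning of the rank-completing perturbation *)

Theorem theorem5p3 (R : realType) (rho r : nat) (r_gt0 : (0 < r)%N)
    (A S T : 'M[R]_(rho + r)) (U V : 'M[R]_(rho + r, r))
    (sigma : 'rV[R]_(rho + r))
    (svdA : is_svd A S sigma T)
    (rankA : \rank A = rho)
    (sigma_rho_gt0 : forall i : 'I_(rho + r), i.+1 = rho -> 0 < sigma 0 i)
    (unitC : A + U *m V^T \in unitmx) :
  let n := (rho + r)%N in
  let C : 'M[R]_(rho + r) := A + U *m V^T in
  let Sigma : 'M[R]_(rho + r) := diag_mx sigma in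
  let Ubar : 'M[R]_(rho, r) := usubmx (S^T *m U) in
  let Ur : 'M[R]_r := dsubmx (S^T *m U) in
  let Vbar : 'M[R]_(rho, r) := usubmx (T^T *m V) in
  let Vr : 'M[R]_r := dsubmx (T^T *m V) in
  let RU : 'M[R]_(rho + r) := block_mx 1%:M Ubar 0 Ur in
  let RV : 'M[R]_(rho + r) := block_mx 1%:M Vbar 0 Vr in
  let E : 'M[R]_(rho + r) := block_mx 0 0 0 1%:M in
  let D : 'M[R]_(rho + r) := Sigma + E in
  [/\ RU *m Sigma *m RV^T = Sigma,
      RU *m E *m RV^T = S^T *m U *m V^T *m T,
      C = S *m RU *m D *m RV^T *m T^T
    & D = diag_mx (\row_(j < rho + r) (if (j < rho)%N then sigma 0 j else 1))]
  /\
  (spectral_norm A = 1 -> Ur \in unitmx -> Vr \in unitmx ->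
   let p := spectral_norm (invmx RU) * spectral_norm (invmx RV) in
   let fr := Num.max 1 (spectral_norm (invmx Ur)) *
             Num.max 1 (spectral_norm (invmx Vr)) in
   1 <= singular_value rho A / singular_value n C <= p
   /\ p <= (1 + spectral_norm U) * (1 + spectral_norm V) * fr).
Proof.
move=> n C Sigma Ubar Ur Vbar Vr RU RV E D.
have [SS TT dec_sigma _ AE] := svdA.
have SSt : S *m S^T = 1%:M by exact: mulmx1C.
have TTt : T *m T^T = 1%:M by exact: mulmx1C.
have sigma_gt0 (i : 'I_rho) : 0 < sigma 0 (lshift r i).
  have rho_gt0 : (0 < rho)%N by exact: leq_ltn_trans (ltn_ord i).
  have last_lt : (rho.-1 < rho + r)%N by rewrite ltn_addr // prednK.
  have := @sigma_rho_gt0 (Ordinal last_lt) (prednK rho_gt0).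
  by move=> /lt_le_trans; apply; apply: dec_sigma; rewrite /= -ltnS prednK.
have sigma_r0 : rsubmx sigma = 0.
  by apply: svd_rsubmx_eq0 svdA rankA _ => i; rewrite mxE.
have SigmaE : Sigma = block_mx (diag_mx (lsubmx sigma)) 0 0 0.
  rewrite /Sigma -[in LHS](hsubmxK sigma) diag_mx_row sigma_r0.
  by congr block_mx; apply/matrixP => i j; rewrite !mxE mul0rn.
have RU_Sigma_RV : RU *m Sigma *m RV^T = Sigma.
  by rewrite SigmaE; exact: bordered_ul_block.
have RU_E_RV : RU *m E *m RV^T = S^T *m U *m V^T *m T.
  by rewrite [LHS]bordered_dr_block trmx_mul trmxK !mulmxA.
have CE : C = S *m RU *m D *m RV^T *m T^T.
  rewrite -!mulmxA (mulmxA RU) (mulmxA (RU *m D)) [RU *m D]mulmxDr mulmxDl.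
  rewrite RU_Sigma_RV RU_E_RV mulmxDl mulmxDr !mulmxA SSt mul1mx.
  by rewrite -[U *m V^T *m T *m T^T]mulmxA TTt mulmx1 -AE.
pose d : 'rV[R]_(rho + r) :=
  \row_(j < rho + r) (if (j < rho)%N then sigma 0 j else 1).
have dE : d = row_mx (lsubmx sigma) (const_mx 1).
  apply/rowP => j; rewrite !mxE; case: split_ordP => i ji.
    by rewrite mxE ji.
  by rewrite mxE.
have DE : D = diag_mx d.
  by rewrite dE diag_mx_row diag_const_mx /D SigmaE add_block_mx !addr0 add0r.
split; first by split.
move=> normA uUr uVr p fr.
(* If [rho = 0] then [A = 0], which contradicts [|A| = 1]. *)
have rho_gt0 : (0 < rho)%N.
  rewrite lt0n; apply/eqP => rho0.
  have A0 : A = 0 by apply/eqP; rewrite -mxrank_eq0 rankA rho0.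
  have : spectral_norm A <= 0.
    by apply: spectral_norm_le => // x; rewrite A0 mul0mx norm20 mul0r.
  by rewrite normA leNgt ltr01.
have n_gt0 : (0 < n)%N by rewrite addn_gt0 rho_gt0.
have last_lt : (rho.-1 < rho)%N by rewrite prednK.
pose l : 'I_rho := Ordinal last_lt; pose k := lshift r l : 'I_n.
have k_succ : k.+1 = rho by rewrite /= prednK.
have sv_A : singular_value rho A = sigma 0 k.
  by rewrite -(svd_singular_value k svdA) k_succ.
have sk_gt0 : 0 < sigma 0 k by exact: sigma_gt0.
have sk_le1 : sigma 0 k <= 1.
  have := norm2_mulmx_le A (T *m delta_mx k 0); rewrite normA mul1r.
  rewrite AE -!mulmxA (mulmxA T^T) TT mul1mx (norm2_orthogonal _ SS).
  rewrite (norm2_orthogonal _ TT) norm2_delta.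
  have -> : diag_mx sigma *m (delta_mx k 0 : 'cV_n) = sigma 0 k *: delta_mx k 0.
    apply/colP => i; rewrite mul_diag_mx !mxE.
    by case: eqP => [->|]; rewrite ?mulr0.
  by rewrite norm2Z norm2_delta mulr1 gtr0_norm.
have sk_le_d i : sigma 0 k <= d 0 i.
  rewrite mxE; case: ifP => // i_lt; apply: dec_sigma.
  by rewrite /= -ltnS prednK.
have uRU : RU \in unitmx by rewrite bordered_unit.
have uRV : RV \in unitmx by rewrite bordered_unit.
set s := singular_value n C.
(* The left inverses of [S *m RU] and [T *m RV] have norms at most those of
   the inverses of [RU] and [RV], because [S] and [T] are orthogonal. *)
have upper : sigma 0 k <= p * s.
  have CE' : C = (S *m RU) *m diag_mx d *m (T *m RV)^T.
    by rewrite CE DE trmx_mul !mulmxA.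
  have inv_left (Q W : 'M[R]_n) : orthogonal_mx Q -> W \in unitmx ->
      invmx W *m Q^T *m (Q *m W) = 1%:M.
    by move=> QQ uW; rewrite mulmxA -(mulmxA _ Q^T) QQ mulmx1 mulVmx.
  have inv_norm (Q W : 'M[R]_n) : orthogonal_mx Q ->
      spectral_norm (invmx W *m Q^T) <= spectral_norm (invmx W).
    move=> QQ; apply: spectral_norm_le => // x.
    rewrite -mulmxA (le_trans (norm2_mulmx_le _ _)) //.
    by rewrite norm2_orthogonal //; exact: orthogonal_mx_tr.
  have := min_singular_value_ge n_gt0 CE' (inv_left _ _ SS uRU)
    (inv_left _ _ TT uRV) sk_gt0 sk_le_d.
  move=> /le_trans; apply; rewrite ler_wpM2r ?singular_value_ge0 //.
  by apply: ler_pM => //; exact: inv_norm.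
have lower : s <= sigma 0 k.
  pose e : 'cV[R]_rho := delta_mx l 0.
  pose y := T *m ((invmx RV)^T *m col_mx e 0).
  have y_ge1 : 1 <= norm2 y.
    rewrite norm2_orthogonal // -(norm2_delta R l).
    exact: norm2_bordered_inv_tr.
  have Cy : C *m y = sigma 0 k *: (S *m col_mx e 0).
    rewrite CE /y -!mulmxA (mulmxA T^T) TT mul1mx (mulmxA RV^T) -trmx_mul.
    rewrite mulVmx // trmx1 mul1mx.
    have -> : D *m col_mx e 0 = sigma 0 k *: col_mx e 0.
      rewrite /D SigmaE add_block_mx !addr0 add0r mul_block_col.
      rewrite !mulmx0 !mul0mx !addr0 scale_col_mx scaler0; congr col_mx.
      apply/colP => i; rewrite mul_diag_mx !mxE.
      by case: eqP => [->|]; rewrite ?mulr0.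
    rewrite -!scalemxAr mul_block_col.
    by rewrite !mulmx0 !mul0mx mul1mx !addr0.
  have [_ /(_ y)] := min_singular_value C n_gt0.
  rewrite Cy norm2Z norm2_orthogonal // gtr0_norm //.
  have -> : norm2 (col_mx e (0 : 'cV[R]_r)) = 1.
    by rewrite norm2_col_mx0 norm2_delta.
  rewrite mulr1; apply: le_trans.
  by rewrite ler_peMr ?singular_value_ge0.
have s_gt0 : 0 < s.
  have s_ge0 : 0 <= s by exact: singular_value_ge0.
  rewrite lt_def s_ge0 andbT; apply: contraTneq upper => ->.
  by rewrite mulr0 -ltNge.
split.
  by rewrite sv_A -/s ler_pdivlMr // mul1r lower ler_pdivrMr.
have bound (Q : 'M[R]_n) (X : 'M[R]_(n, r)) :
    orthogonal_mx Q -> dsubmx (Q^T *m X) \in unitmx ->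
    spectral_norm (invmx (bordered (Q^T *m X))) <= (1 + spectral_norm X) *
      Num.max 1 (spectral_norm (invmx (dsubmx (Q^T *m X)))).
  move=> QQ uX; apply: (le_trans (spectral_norm_invmx_bordered uX)).
  rewrite ler_wpM2r ?le_max ?ler01 // lerD2l spectral_norm_orthogonal_le //.
  exact: orthogonal_mx_tr.
by rewrite /fr mulrACA; apply: ler_pM => //; exact: bound.
Qed.
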